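(* Let $n\ge 1$, $d\ge 2$ and $a=2^{i_1}+2^{i_2}+\cdots+2^{i_d}$ with integers $i_1>i_2>\cdots>i_d=0$. For $1\le k\le d$ let $S_k$ be the set of every $2^{i_k}$-th vertex of the cycle $C_{2^{n2^{i_k+1}}}$ (so for $k=d$ the cycle is $C_{2^{2n}}$ and $S_d$ is its whole vertex set). Then for every integer $\alpha$ with $1\le\alpha\le 2n$, the anchored product $$(C_{2^{n2^{i_1+1}}},S_1)\boxplus(C_{2^{n2^{i_2+1}}},S_2)\boxplus(C_{2^{2n}},S_d)\boxplus(C_{2^{n2^{i_3+1}}},S_3)\boxplus\cdots\boxplus(C_{2^{n2^{i_{d-1}+1}}},S_{d-1})$$ (each index $1,\dots,d$ occurring exactly once; for $d=2$ this is $(C_{2^{n2^{i_1+1}}},S_1)\boxplus(C_{2^{2n}},S_2)$) has a $d$-dimensional $2^{\alpha-1}$-square decomposition into cycles $C_{a\cdot 2^{\alpha}}$ of length $a\cdot 2^\alpha$.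
   Context: $C_b$ is the cycle of length $b$. A decomposition of a graph is a family of subgraphs with pairwise disjoint edge sets whose union is the graph. ''Every $m$-th vertex'' of a cycle $C_y$ with $m\mid y$ means a set of $y/m$ vertices equally spaced at distance $m$ along the cycle. Anchored product: for graphs $G_k$ with $S_k\subseteq V(G_k)$, $(G_1,S_1)\boxplus(G_2,S_2)$ has vertices $(j_1,j_2)$ with $j_1\in S_1$ or $j_2\in S_2$, and edges $(j_1,j_2)(j_1',j_2')$ with either $j_1j_1'\in E(G_1)$ and $j_2=j_2'\in S_2$, or $j_2j_2'\in E(G_2)$ and $j_1=j_1'\in S_1$. For $d$ factors, $(G_1,S_1)\boxplus\cdots\boxplus(G_d,S_d)$ has as vertices the tuples $(j_1,\dots,j_d)$ with $j_k\in S_k$ for all but at most one $k$, and as edges the pairs of tuples that differ in exactly one coordinate $k$, along an edge of $G_k$, all other coordinates lying in the respective $S_j$. With the cycles and sets $S_k$ of the claim the anchored product is a subdivision of the torus (underlying torus) $\square_{k}C_{|S_k|}$, each torus edge along dimension $k$ being replaced by a path of $2^{i_k}$ edges. A $d$-dimensional $\lambda$-square decomposition of the anchored product is a decomposition into cycles obtained by so subdividing the cycles of a decomposition of the underlying torus, in which each cycle consists of $2d$ straight sides of $\lambda$ consecutive edges each, two sides along each of the $d$ dimensions. *)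

(* Defs.v *)
From HB Require Import structures.
From mathcomp Require Import all_boot.

Set Implicit Arguments.
Unset Strict Implicit.
Unset Printing Implicit Defensive.

(* An edge is the set of its two ends. *)
Record graph (T : finType) := Graph {
  verts : {set T};
  edges : {set {set T}}
}.

Definition map_graph (T U : finType) (f : T -> U) (G : graph T) : graph U :=
  Graph [set f x | x in verts G]
        [set [set f x | x in e] | e : {set T} in edges G].

(* The graph on Z/b with edges {x, x+1}; [ordS] is x |-> x+1 modulo b.  It is
   the simple cycle of length b only for b >= 3. *)
Definition cycle_graph (b : nat) : graph 'I_b :=
  Graph [set: 'I_b] [set [set x; ordS x] | x : 'I_b].

Definition cycle_along (T : finType) (b : nat) (f : 'I_b -> T) (H : graph T) :
    Prop :=
  [/\ 2 < b, injective f & H = map_graph f (cycle_graph b)].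

Definition is_cycle (T : finType) (b : nat) (H : graph T) : Prop :=
  exists f : 'I_b -> T, cycle_along f H.

Definition decomposition (T I : finType) (G : graph T) (F : I -> graph T) :
    Prop :=
  [/\ forall i j, i != j -> [disjoint edges (F i) & edges (F j)],
      \bigcup_i verts (F i) = verts G
    & \bigcup_i edges (F i) = edges G].

Definition anchored_product (d : nat) (T : 'I_d -> finType)
    (G : forall k, graph (T k)) (S : forall k, {set T k}) :
    graph {dffun forall k : 'I_d, T k} :=
  Graph
    [set x : {dffun forall k : 'I_d, T k} |
       [forall k, x k \in verts (G k)] && (#|[set k | x k \notin S k]| <= 1)]
    [set e : {set {dffun forall k : 'I_d, T k}} |
       [exists x, exists y, (e == [set x; y]) &&
         [exists k, ([set x k; y k] \in edges (G k)) &&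
           [forall j, (j != k) ==> (x j == y j) && (x j \in S j)]]]].

(* Anchoring every factor at all its vertices leaves no room for a free
   coordinate: this is the usual Cartesian product. *)
Definition cartesian_product (d : nat) (T : 'I_d -> finType)
    (G : forall k, graph (T k)) : graph {dffun forall k : 'I_d, T k} :=
  anchored_product G (fun k => verts (G k)).

Definition every_nth (w y : nat) : {set 'I_y} := [set x : 'I_y | w %| x].

(* Below, y k is the length of the k-th cycle and w k, a divisor of y k, the
   spacing of its anchors, so that there are y k %/ w k anchors. *)

Notation grid y := {dffun forall k : 'I__, 'I_(y k)}.
Notation torus_grid y w := {dffun forall k : 'I__, 'I_(y k %/ w k)}.

Definition anchored_cycles (d : nat) (y w : 'I_d -> nat) : graph (grid y) :=
  anchored_product (fun k => cycle_graph (y k))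
                   (fun k => every_nth (w k) (y k)).

Definition torus (d : nat) (q : 'I_d -> nat) : graph (grid q) :=
  cartesian_product (fun k => cycle_graph (q k)).

Definition move (d : nat) (q : 'I_d -> nat) (k : 'I_d) (r : nat) (t : grid q) :
    grid q :=
  [ffun j => iter (if j == k then r else 0) (@ordS (q j)) (t j)].

Fact anchor_subproof (y w : nat) (t : 'I_(y %/ w)) : t * w < y.
Proof.
case: w t => [|w] [t /= lt_t]; first by rewrite divn0 in lt_t.
by apply: leq_trans (leq_divM y w.+1); rewrite ltn_pmul2r.
Qed.

Definition anchor (y w : nat) (t : 'I_(y %/ w)) : 'I_y :=
  Ordinal (anchor_subproof t).

Definition embed (d : nat) (y w : 'I_d -> nat)
    (t : torus_grid y w) : grid y :=
  [ffun k => anchor (t k)].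

(* The graph obtained from a subgraph H of the torus by replacing each edge
   {t, t + e_k} by the path of w k edges from [embed t] along dimension k. *)
Definition subdivide (d : nat) (y w : 'I_d -> nat)
    (H : graph (torus_grid y w)) : graph (grid y) :=
  Graph
    ([set embed t | t in verts H] :|:
     [set v | [exists t : torus_grid y w, exists k : 'I_d,
        ([set t; move k 1 t] \in edges H) &&
        [exists r : 'I_(w k), v == move k r (embed t)]]])
    [set e | [exists t : torus_grid y w, exists k : 'I_d,
        ([set t; move k 1 t] \in edges H) &&
        [exists r : 'I_(w k),
           e == [set move k r (embed t); move k r.+1 (embed t)]]]].

(* A cycle made of 2d straight sides of lam edges.  Side s consists of the steps
   x with s * lam <= x < (s + 1) * lam and runs along dimension [dim s], all its
   steps in the positive direction or all in the negative one.  Consecutive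
   sides cannot have the same dimension when d >= 2, since f is injective. *)
Definition square_cycle (d : nat) (q : 'I_d -> nat) (lam : nat)
    (H : graph (grid q)) : Prop :=
  exists (f : 'I_(2 * d * lam) -> grid q)
         (dim : 'I_(2 * d) -> 'I_d) (pos : 'I_(2 * d) -> bool),
  [/\ cycle_along f H,
      forall k, #|[set s | dim s == k]| = 2
    & forall (s : 'I_(2 * d)) (x : 'I_(2 * d * lam)), x %/ lam = s ->
        if pos s then f (ordS x) = move (dim s) 1 (f x)
        else f x = move (dim s) 1 (f (ordS x))].

Definition square_decomposition (d : nat) (y w : 'I_d -> nat) (lam : nat)
    (I : finType) (F : I -> graph (grid y)) : Prop :=
  [/\ decomposition (anchored_cycles y w) F,
      forall i, exists b, is_cycle b (F i)
    & exists D : I -> graph (torus_grid y w),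
        [/\ decomposition (torus (fun k => y k %/ w k)) D,
            forall i, square_cycle lam (D i)
          & forall i, F i = subdivide (D i)]].

(* Position p (from 0) of the list 1, 2, d, 3, ..., d-1, or 1, 2 if d = 2. *)
Definition factor_index (d p : nat) : nat :=
  if p < 2 then p.+1 else if p == 2 then d else p.

Definition factor_length (n d : nat) (i : nat -> nat) (p : 'I_d) : nat :=
  2 ^ (n * 2 ^ (i (factor_index d p)).+1).

Definition factor_spacing (d : nat) (i : nat -> nat) (p : 'I_d) : nat :=
  2 ^ i (factor_index d p).

(* Main.v *)
Require Import Defs.
From HB Require Import structures.
From mathcomp Require Import all_boot.
From mathcomp Require Import zify.

Set Implicit Arguments.
Unset Strict Implicit.
Unset Printing Implicit Defensive.

(** Write lam for 2^(alpha-1), w_k for the spacing of the anchors of factor k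
    and q_k for their number. The exponent of q_k is n 2^(i+1) - i >= 2n,
    where i is the exponent of w_k, so 2 lam divides every q_k. This
    divisibility is the only arithmetic that matters: any product of at least
    two cycles, of lengths q_k >= 3 divisible by 2 lam, has a lam-square
    decomposition ([torus_ladders]).

    All cycles are translates of one shape, the ladder. From its base v it
    goes up along dimensions 0, 1, ..., d-1 in turn, then down along 0, d-1,
    ..., 1. It is the boundary of a strip whose two rails follow the
    staircase e_1, ..., e_(d-1) and whose two ends run along e_0. It has two
    sides along each dimension k; with sides of length lam, their lower ends
    are v + lam c and v + lam c', where c and c' are the 0-1 vectors
    [corner k true] and [corner k false].

    The bases are the v whose coordinate sum is divisible by lam and whose
    cell, in the grid of cubes of side lam, has an even sum of indices 0 and
    1. Let an edge go from t to t + e_k. The coordinate sum of t modulo lam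
    tells how far back along dimension k the side containing the edge has to
    start. That start u leaves two candidate bases, u - lam c and u - lam c'.
    In coordinates 0 and 1 together c and c' differ by an odd amount
    ([corner_parity]), so exactly one candidate has an even cell. Hence every
    edge of the torus is in exactly one ladder ([ladder_partition]).

    Subdividing the ladder at v gives the ladder at [embed v] whose sides
    along dimension k have length lam w_k ([subdivide_ladder]). So ladders
    are studied for arbitrary side lengths l_k: one argument shows that a
    ladder is a cycle of length 2 (l_0 + ... + l_(d-1)), both in the torus
    and in the anchored product, where this length is 2 lam (w_0 + ... +
    w_(d-1)), that is 2^alpha a. *)

(** * Translations and oriented edges of a torus *)

Definition shift (d : nat) (q : 'I_d -> nat) (m : 'I_d -> nat) (t : grid q) :
    grid q :=
  [ffun k => iter (m k) (@ordS (q k)) (t k)].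

Definition edge_from (d : nat) (q : 'I_d -> nat) (t : grid q) (k : 'I_d) :
    {set grid q} :=
  [set t; move k 1 t].

Lemma iter_ordS (n r : nat) (x : 'I_n) :
  iter r (@ordS n) x = (x + r) %% n :> nat.
Proof.
elim: r => [|r IHr] /=; first by rewrite addn0 modn_small.
by rewrite IHr -addn1 modnDml addn1 addnS.
Qed.

Lemma shiftE (d : nat) (q : 'I_d -> nat) (m : 'I_d -> nat) (t : grid q) k :
  shift m t k = (t k + m k) %% q k :> nat.
Proof. by rewrite ffunE iter_ordS. Qed.

Lemma moveE (d : nat) (q : 'I_d -> nat) (k : 'I_d) r (t : grid q) j :
  move k r t j = (t j + (if j == k then r else 0)) %% q j :> nat.
Proof. exact: shiftE. Qed.

Lemma grid_inj (d : nat) (q : 'I_d -> nat) (t u : grid q) :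
  (forall k, t k = u k :> nat) -> t = u.
Proof. by move=> eq_tu; apply/ffunP => k; apply/val_inj/eq_tu. Qed.

Lemma shift_id (d : nat) (q m : 'I_d -> nat) (t : grid q) :
  (forall k, q k %| m k) -> shift m t = t.
Proof.
move=> dvd_qm; apply: grid_inj => k; rewrite shiftE.
by rewrite -modnDmr (eqP (dvd_qm k)) addn0 modn_small.
Qed.

Lemma shiftD (d : nat) (q m m' : 'I_d -> nat) (t : grid q) :
  shift m' (shift m t) = shift (fun k => m k + m' k) t.
Proof. by apply: grid_inj => k; rewrite !shiftE modnDml addnA. Qed.

Lemma shift_ext (d : nat) (q m m' : 'I_d -> nat) (t : grid q) :
  m =1 m' -> shift m t = shift m' t.
Proof. by move=> eq_m; apply: grid_inj => k; rewrite !shiftE eq_m. Qed.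

Lemma move_shift (d : nat) (q : 'I_d -> nat) (t : grid q) k r :
  move k r t = shift (fun j => (j == k) * r) t.
Proof.
by apply: grid_inj => j; rewrite shiftE moveE; case: eqP; rewrite ?mul1n.
Qed.

Lemma shift_move (d : nat) (q m : 'I_d -> nat) (t : grid q) k r :
  move k r (shift m t) = shift (fun j => m j + (j == k) * r) t.
Proof. by rewrite move_shift shiftD. Qed.

Lemma move1_move (d : nat) (q : 'I_d -> nat) (t : grid q) k r :
  move k 1 (move k r t) = move k r.+1 t.
Proof.
rewrite !move_shift shiftD; apply: shift_ext => j.
by rewrite -mulnDr addn1.
Qed.

Lemma shift_inj (d : nat) (q m m' : 'I_d -> nat) (t : grid q) :
  (forall k, m k < q k) -> (forall k, m' k < q k) ->
  shift m t = shift m' t -> m =1 m'.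
Proof.
move=> lt_m lt_m' /ffunP eq_mm' k.
have /eqP := congr1 val (eq_mm' k); rewrite /= !shiftE eqn_modDl.
by rewrite !modn_small // => /eqP.
Qed.

Lemma modSn_neq (n x : nat) : 1 < n -> x < n -> x.+1 %% n <> x.
Proof.
move=> n_gt1; rewrite leq_eqVlt => /orP[/eqP eq_n|lt_n].
  by rewrite eq_n modnn; lia.
by rewrite modn_small //; lia.
Qed.

Lemma modSSn_neq (n x : nat) : 2 < n -> x < n -> (x.+1 %% n).+1 %% n <> x.
Proof.
move=> n_gt2 lt_xn; rewrite -addn1 modnDml addn1.
move: lt_xn; rewrite leq_eqVlt => /orP[/eqP eq_n|lt_n].
  by rewrite -addn1 eq_n modnDl modn_small; lia.
move: lt_n; rewrite leq_eqVlt => /orP[/eqP eq_n|lt_n].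
  by rewrite eq_n modnn; lia.
by rewrite modn_small //; lia.
Qed.

Lemma move1E (d : nat) (q : 'I_d -> nat) (k : 'I_d) (t : grid q) j :
  move k 1 t j = (if j == k then (t j).+1 %% q j else t j) :> nat.
Proof.
by rewrite moveE; case: eqP => _; rewrite ?addn1 // addn0 modn_small.
Qed.

(** On cycles of length at least 3 an edge determines its orientation, so a
    set of edges can be handled as a set of pairs of a start and a dimension. *)
Lemma edge_from_inj (d : nat) (q : 'I_d -> nat) (t t' : grid q) k k' :
  (forall j, 2 < q j) -> edge_from t k = edge_from t' k' -> t = t' /\ k = k'.
Proof.
move=> q_gt2 eqA.
have neq (u : grid q) j : move j 1 u <> u.
  move=> /ffunP/(_ j)/(congr1 val) /=; rewrite move1E eqxx.
  by apply: modSn_neq => //; apply: ltnW.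
have: t \in edge_from t' k' by rewrite -eqA set21.
have: move k 1 t \in edge_from t' k' by rewrite -eqA set22.
rewrite !inE => /orP[]/eqP m_t /orP[]/eqP def_t.
- by case: (neq t k); rewrite m_t.
- have := congr1 (fun u : grid q => u k : nat) m_t.
  rewrite move1E eqxx => tk1.
  have := congr1 (fun u : grid q => u k : nat) def_t.
  rewrite move1E -tk1; case: eqP => _ /esym eqk.
    by case: (@modSSn_neq (q k) (t k)).
  by case: (@modSn_neq (q k) (t k)) => //; apply: ltnW.
- split=> //; have := congr1 (fun u : grid q => u k : nat) m_t.
  rewrite !move1E eqxx -def_t; case: eqP => // _ eqk.
  by case: (@modSn_neq (q k) (t k)) => //; apply: ltnW.
by case: (neq t k); rewrite m_t.
Qed.

(** Lets a closed walk be indexed by natural numbers instead of residues. *)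
Lemma closed_walk (T : finType) (b : nat) (g : nat -> T) (x : 'I_b) :
  g b = g 0 -> g (ordS x) = g x.+1.
Proof.
move=> g_b /=; have := ltn_ord x; rewrite leq_eqVlt => /orP[/eqP->|lt_xb].
  by rewrite modnn g_b.
by rewrite modn_small.
Qed.

(** * Edges of cycles, products and subdivisions *)

Lemma set2_eq (T : finType) (a b c e : T) :
  [set a; b] = [set c; e] -> (a = c /\ b = e) \/ (a = e /\ b = c).
Proof.
move=> eqS; have: a \in [set c; e] by rewrite -eqS set21.
have: b \in [set c; e] by rewrite -eqS set22.
have: c \in [set a; b] by rewrite eqS set21.
have: e \in [set a; b] by rewrite eqS set22.
by do 4![case/set2P=> ?]; subst; auto.
Qed.

Lemma graph_ext (T : finType) (G H : graph T) :
  verts G = verts H -> edges G = edges H -> G = H.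
Proof. by case: G H => [V E] [V' E'] /= -> ->. Qed.

Lemma cycle_edgesP (T : finType) (b : nat) (f : 'I_b -> T) (E : {set T}) :
  reflect (exists x, E = [set f x; f (ordS x)])
          (E \in edges (map_graph f (cycle_graph b))).
Proof.
have im2 x : [set f z | z in [set x; ordS x]] = [set f x; f (ordS x)].
  by rewrite imsetU1 imset_set1.
apply: (iffP imsetP) => [[_ /imsetP[x _ ->] ->]|[x ->]].
  by exists x; apply: im2.
by exists [set x; ordS x]; rewrite ?im2 //; apply: imset_f.
Qed.

(** A cycle has no isolated vertex. Nor has its subdivision, by
    [subdivide_cover]; two such graphs are equal as soon as their edges are. *)
Lemma cycle_cover (T : finType) (b : nat) (f : 'I_b -> T) :
  let C := map_graph f (cycle_graph b) in verts C = cover (edges C).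
Proof.
move=> C; apply/setP => u.
apply/imsetP/bigcupP => [[x _ ->]|[_ /cycle_edgesP[x ->]]].
  exists [set f x; f (ordS x)]; last exact: set21.
  by apply/cycle_edgesP; exists x.
by rewrite !inE => /orP[]/eqP->; [exists x | exists (ordS x)].
Qed.

Lemma product_edgesP (d : nat) (q : 'I_d -> nat) (S : forall k, {set 'I_(q k)})
    (E : {set grid q}) :
  reflect (exists t k, E = edge_from t k /\ forall j, j != k -> t j \in S j)
    (E \in edges (anchored_product (fun k => cycle_graph (q k)) S)).
Proof.
rewrite inE; apply: (iffP existsP) => [[x /existsP[y /andP[/eqP-> ]]]|].
  case/existsP=> k /andP[/imsetP[z _ /set2_eq eq_xy] /forallP xyS].
  have xyj j : j != k -> x j = y j /\ x j \in S j.
    by move=> j_k; move: (xyS j); rewrite j_k => /andP[/eqP].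
  have def_m (u v : grid q) : u k = z -> v k = ordS z ->
      (forall j, j != k -> u j = v j) -> v = move k 1 u.
    move=> uk vk uv; apply: grid_inj => j; rewrite move1E.
    by case: (eqVneq j k) => [->|/uv->] //; rewrite vk uk.
  case: eq_xy => [][xk yk]; [exists x, k | exists y, k]; split.
  - by rewrite /edge_from -(def_m x y) // => j /xyj[].
  - by move=> j /xyj[].
  - by rewrite /edge_from -(def_m y x) 1?setUC // => j /xyj[].
  by move=> j /xyj[->].
case=> t [k [-> tS]]; exists t; apply/existsP; exists (move k 1 t).
rewrite eqxx /=; apply/existsP; exists k; apply/andP; split.
  by apply/imsetP; exists (t k); rewrite ?ffunE ?eqxx.
apply/forallP => j; apply/implyP => j_k; rewrite tS // andbT.
by apply/eqP/val_inj; rewrite /= move1E (negPf j_k).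
Qed.

Lemma torus_verts (d : nat) (q : 'I_d -> nat) (t : grid q) :
  t \in verts (torus q).
Proof.
rewrite inE; apply/andP; split; first by apply/forallP => k; rewrite inE.
by rewrite (_ : [set k | _] = set0) ?cards0 //; apply/setP => k; rewrite !inE.
Qed.

Lemma torus_edge (d : nat) (q : 'I_d -> nat) (t : grid q) k :
  edge_from t k \in edges (torus q).
Proof. by apply/product_edgesP; exists t, k; split=> // j _; rewrite inE. Qed.

Lemma torus_edgesP (d : nat) (q : 'I_d -> nat) (E : {set grid q}) :
  E \in edges (torus q) -> exists t k, E = edge_from t k.
Proof. by case/product_edgesP=> t [k [-> _]]; exists t, k. Qed.

(** The interior of a subdivided edge never wraps around its cycle: t_k w_k +
    r is less than (t_k + 1) w_k <= y_k. Division by w_k thus recovers the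
    edge. *)
Lemma inner_valE (d : nat) (y w : 'I_d -> nat) (t : torus_grid y w) k r j :
  r < w k -> move k r (embed t) j = t j * w j + (j == k) * r :> nat.
Proof.
move=> lt_rw; rewrite moveE ffunE /=.
suff lt_y : t j * w j + (j == k) * r < y j.
  by rewrite modn_small //; case: eqP lt_y => _; rewrite ?mul1n.
have := ltn_ord (t j); have := leq_divM (y j) (w j); rewrite mulnC.
by case: eqP => [->|_]; nia.
Qed.

Lemma inner_inj (d : nat) (y w : 'I_d -> nat) (t t' : torus_grid y w) k r r' :
    (forall j, 0 < w j) -> r < w k -> r' < w k ->
  move k r (embed t) = move k r' (embed t') -> t = t'.
Proof.
move=> w_gt0 lt_r lt_r' eqm; apply: grid_inj => j.
have := congr1 (fun u : grid y => u j %/ w j) eqm; rewrite /= !inner_valE //.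
have small s : s < w k -> ((j == k) * s) %/ w j = 0.
  by move=> lt_s; case: eqP => [->|_]; rewrite ?mul1n ?div0n ?divn_small.
by rewrite !divnMDl // !small // !addn0.
Qed.

(** Division with remainder by w in each coordinate: a vertex of the anchored
    product has at most one nonzero remainder, which says on which subdivided
    edge it lies. *)
Lemma nearest_anchor (d : nat) (y w : 'I_d -> nat) (x : grid y) :
    (forall j, 0 < w j) -> (forall j, w j %| y j) ->
  exists t : torus_grid y w, x = shift (fun j => x j %% w j) (embed t).
Proof.
move=> w_gt0 w_y.
have lt_q j : x j %/ w j < y j %/ w j by rewrite ltn_divLR // divnK.
exists [ffun j => Ordinal (lt_q j)]; apply: grid_inj => j.
by rewrite shiftE !ffunE /= -divn_eq modn_small.
Qed.

Lemma embed_shift (d : nat) (y w : 'I_d -> nat) (t : torus_grid y w) m :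
    (forall j, w j %| y j) ->
  embed (shift m t) = shift (fun j => w j * m j) (embed t).
Proof.
move=> w_y; apply: grid_inj => j; rewrite shiftE [embed (shift _ _) j]ffunE /=.
by rewrite shiftE ffunE /= [w j * _]mulnC -mulnDl muln_modl divnK.
Qed.

Lemma subdivide_edgesP (d : nat) (y w : 'I_d -> nat)
    (H : graph (torus_grid y w)) (E : {set grid y}) :
  reflect (exists t k r,
             [/\ edge_from t k \in edges H, r < w k
               & E = edge_from (move k r (embed t)) k])
          (E \in edges (subdivide H)).
Proof.
have next (t : torus_grid y w) k r :
    [set move k r (embed t); move k r.+1 (embed t)]
      = edge_from (move k r (embed t)) k.
  by rewrite /edge_from move1_move.
rewrite inE; apply: (iffP existsP).
  case=> t /existsP[k /andP[tH /existsP[r /eqP->]]].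
  by exists t, k, r; split.
case=> t [k [r [tH lt_r ->]]]; exists t; apply/existsP; exists k.
by rewrite tH /=; apply/existsP; exists (Ordinal lt_r); rewrite /= next.
Qed.

(** Every edge of the anchored product is a piece of exactly one subdivided
    torus edge, because dividing its start by w gives that torus edge. *)
Lemma subdivide_decomposition (d : nat) (y w : 'I_d -> nat) (I : finType)
    (D : I -> graph (torus_grid y w)) :
    (forall j, 0 < w j) -> (forall j, w j %| y j) -> (forall j, 2 < y j) ->
  decomposition (torus (fun k => y k %/ w k)) D ->
  decomposition (anchored_cycles y w) (fun i => subdivide (D i)).
Proof.
move=> w_gt0 w_y y_gt2 [disjD vertsD edgesD].
have edgeD t k : exists2 i, i \in I & edge_from t k \in edges (D i).
  by have := torus_edge t k; rewrite -edgesD => /bigcupP[i]; exists i.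
have anchored (t : torus_grid y w) k r j : r < w k -> j != k ->
    move k r (embed t) j \in every_nth (w j) (y j).
  by move=> lt_r j_k; rewrite inE inner_valE // (negPf j_k) addn0 dvdn_mull.
split=> [i j i_j||].
- rewrite disjoint_subset; apply/subsetP => E /subdivide_edgesP[t [k [r]]].
  case=> tDi lt_r ->{E}; apply/negP.
  move=> /subdivide_edgesP[t' [k' [r' [tDj lt_r']]]].
  case/edge_from_inj => // eq_m eq_k; subst k'.
  have eq_t : t = t' by apply: inner_inj eq_m.
  have /disjointFr := disjD _ _ i_j => /(_ _ tDi).
  by rewrite eq_t tDj.
- apply/setP => x; apply/bigcupP/idP => [[i _]|].
    rewrite !inE => /orP x_i; apply/andP; split.
      by apply/forallP => k; rewrite inE.
    case: x_i => [/imsetP[t _ ->]|].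
      rewrite (_ : [set k | _] = set0) ?cards0 //; apply/setP => k.
      by rewrite !inE ffunE /= dvdn_mull.
    case/existsP=> t /existsP[k /andP[_ /existsP[r /eqP->]]].
    rewrite -(cards1 k); apply/subset_leq_card/subsetP => j; rewrite !inE.
    apply: contraR => j_k; have := anchored t k r j (ltn_ord r) j_k.
    by rewrite inE.
  rewrite inE => /andP[_ le1].
  have [t def_x] := nearest_anchor x w_gt0 w_y.
  have: exists2 A : {set 'I_d}, #|A| <= 1 & forall k, k \notin A -> w k %| x k.
    exists [set k | x k \notin every_nth (w k) (y k)] => // k.
    by rewrite !inE negbK.
  case=> A; rewrite leq_eqVlt => /orP[/cards1P[k ->]|A0] dvd_x.
    have [i _ tDi] := edgeD t k; exists i => //.
    rewrite inE; apply/orP; right; rewrite inE; apply/existsP; exists t.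
    apply/existsP; exists k; rewrite [_ \in _]tDi /=.
    have lt_r : x k %% w k < w k by rewrite ltn_mod.
    apply/existsP; exists (Ordinal lt_r); rewrite {1}def_x move_shift /=.
    apply/eqP; apply: shift_ext => j.
    case: eqP => [->|/eqP j_k]; rewrite ?mul1n //.
    by apply/eqP/dvd_x; rewrite inE.
  have: t \in \bigcup_i verts (D i) by rewrite vertsD torus_verts.
  case/bigcupP=> i _ tDi; exists i => //; rewrite inE; apply/orP; left.
  apply/imsetP; exists t => //; rewrite def_x; rewrite shift_id // => j.
  move: A0; rewrite ltnS leqn0 cards_eq0 => /eqP A0.
  rewrite (eqP (dvd_x j _)) ?dvdn0 //.
  by rewrite A0 inE.
apply/setP => E; apply/bigcupP/product_edgesP => [[i _]|].
  case/subdivide_edgesP=> t [k [r [tDi lt_r ->]]].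
  by exists (move k r (embed t)), k; split=> // j; apply: anchored.
case=> x [k [-> xS]]; have [t def_x] := nearest_anchor x w_gt0 w_y.
have [i _ tDi] := edgeD t k; exists i => //; apply/subdivide_edgesP.
exists t, k, (x k %% w k); split; rewrite ?ltn_mod //; congr (edge_from _ _).
rewrite {1}def_x move_shift; apply: shift_ext => j.
case: eqP => [->|/eqP j_k]; first by rewrite mul1n.
by apply/eqP; have := xS _ j_k; rewrite inE.
Qed.

Lemma subdivide_cover (d : nat) (y w : 'I_d -> nat)
    (H : graph (torus_grid y w)) :
    (forall j, 0 < w j) -> (forall j, w j %| y j) ->
    edges H \subset edges (torus (fun k => y k %/ w k)) ->
    verts H = cover (edges H) ->
  verts (subdivide H) = cover (edges (subdivide H)).
Proof.
move=> w_gt0 w_y sHT vertsH.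
have embed_move (t : torus_grid y w) k :
    embed (move k 1 t) = move k (w k) (embed t).
  rewrite !move_shift embed_shift //; apply: shift_ext => j.
  by case: eqP => [->|]; rewrite ?muln1 ?muln0 ?mul1n.
have move0 (u : grid y) k : move k 0 u = u.
  by rewrite move_shift shift_id // => j; rewrite muln0 dvdn0.
apply/setP => u; apply/setUP/bigcupP => [[/imsetP[t]|]|].
- rewrite vertsH => /bigcupP[E EH].
  have /subsetP/(_ E EH)/torus_edgesP[t' [k def_E]] := sHT.
  rewrite def_E in EH *.
  rewrite !inE => /orP[]/eqP-> ->.
    exists (edge_from (move k 0 (embed t')) k); last by rewrite move0 set21.
    by apply/subdivide_edgesP; exists t', k, 0.
  exists (edge_from (move k (w k).-1 (embed t')) k).
    by apply/subdivide_edgesP; exists t', k, (w k).-1; rewrite prednK.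
  by rewrite /edge_from move1_move prednK // embed_move set22.
- rewrite inE => /existsP[t /existsP[k /andP[tH /existsP[r /eqP->]]]].
  exists (edge_from (move k r (embed t)) k); last exact: set21.
  by apply/subdivide_edgesP; exists t, k, r.
case=> E /subdivide_edgesP[t [k [r [tH lt_r ->]]]].
have inner r' : r' < w k ->
    move k r' (embed t) \in [set v |
      [exists t : torus_grid y w, exists k : 'I_d,
        ([set t; move k 1 t] \in edges H) &&
        [exists r : 'I_(w k), v == move k r (embed t)]]].
  move=> lt_r'; rewrite inE; apply/existsP; exists t; apply/existsP; exists k.
  by rewrite [_ \in _]tH /=; apply/existsP; exists (Ordinal lt_r').
case/set2P=> ->; first by right; apply: inner.
rewrite move1_move; move: lt_r; rewrite leq_eqVlt => /orP[/eqP->|/inner].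
  2: by right.
left; rewrite -embed_move; apply: imset_f; rewrite vertsH; apply/bigcupP.
by exists (edge_from t k); rewrite // set22.
Qed.

(** * The shape of a ladder *)

(** On the ladder that goes up along 0, 1, ..., n-1 and down along 0, n-1,
    ..., 1, the set of dimensions j that have been climbed and not yet
    descended at the lower end of the upward, respectively downward, side
    along k. *)
Definition corner (n : nat) (k : 'I_n) (up : bool) (j : 'I_n) : bool :=
  if up then j < k else (0 < j) && ((k == 0 :> nat) || (j < k)).

(** Displacement from the base to the point at distance r from the lower end
    of a side along k. *)
Definition offset (n : nat) (l : 'I_n -> nat) (k : 'I_n) (up : bool) (r : nat)
    (j : 'I_n) : nat :=
  l j * corner k up j + (j == k) * r.

Definition prefix_length (n : nat) (l : 'I_n -> nat) (m : nat) : nat :=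
  \sum_(j < n | j < m) l j.

(** Position on the walk at which the downward side along k begins. After the
    side along 0 the walk comes back in reverse order: with B half its
    length, the points at positions p and 2B + l_0 - p face each other on the
    two rails. *)
Definition down_start (n : nat) (l : 'I_n.+2 -> nat) (k : 'I_n.+2) : nat :=
  if k == 0 :> nat then \sum_j l j
  else 2 * (\sum_j l j) + l ord0 - prefix_length l k.+1.

(** Position on the walk of the point at distance r from the lower end of a
    side along k; downward sides are traversed from r = l_k to r = 0. *)
Definition side_pos (n : nat) (l : 'I_n.+2 -> nat) (k : 'I_n.+2) (up : bool)
    (r : nat) : nat :=
  if up then prefix_length l k + r else down_start l k + (l k - r).

(** Coordinate j of the walk at time x relative to its base: it rises by l_j
    on the upward side along j and falls by l_j on the downward one. *)
Definition height (n : nat) (l : 'I_n.+2 -> nat) (x : nat) (j : 'I_n.+2) :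
    nat :=
  minn (x - prefix_length l j) (l j) - minn (x - down_start l j) (l j).

Lemma prefix_length0 (n : nat) (l : 'I_n -> nat) : prefix_length l 0 = 0.
Proof. by rewrite /prefix_length big_pred0. Qed.

Lemma prefix_lengthS (n : nat) (l : 'I_n -> nat) (k : 'I_n) :
  prefix_length l k.+1 = prefix_length l k + l k.
Proof.
rewrite /prefix_length (bigD1 k) //= addnC; congr (_ + _).
by apply: eq_bigl => j; rewrite -val_eqE /=; lia.
Qed.

Lemma prefix_length_full (n : nat) (l : 'I_n -> nat) :
  prefix_length l n = \sum_j l j.
Proof. by apply: eq_bigl => j; rewrite ltn_ord. Qed.

Lemma leq_prefix_length (n : nat) (l : 'I_n -> nat) (m m' : nat) :
  m <= m' -> prefix_length l m <= prefix_length l m'.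
Proof.
move=> le_m; rewrite /prefix_length.
rewrite [X in _ <= X](bigID (fun j : 'I_n => j < m)).
apply: leq_trans (leq_addr _ _); rewrite leq_eqVlt; apply/orP; left; apply/eqP.
by apply: eq_bigl => j /=; lia.
Qed.

Lemma prefix_lengthP (n : nat) (l : 'I_n -> nat) (x : nat) :
    x < \sum_j l j ->
  exists2 k : 'I_n, prefix_length l k <= x & x < prefix_length l k + l k.
Proof.
move=> lt_x; have exm : exists m, x < prefix_length l m.
  by exists n; rewrite prefix_length_full.
case: (ex_minnP exm) => -[|m]; rewrite ?prefix_length0 // => lt_m min_m.
have lt_mn : m < n by apply: min_m; rewrite prefix_length_full.
exists (Ordinal lt_mn); last by rewrite -(prefix_lengthS l (Ordinal lt_mn)).
by rewrite leqNgt; apply/negP => /min_m; rewrite ltnn.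
Qed.

Lemma prefix_length_sep (n : nat) (l : 'I_n -> nat) (j k : 'I_n) :
  j < k -> prefix_length l j + l j <= prefix_length l k.
Proof. by move=> lt_jk; rewrite -prefix_lengthS leq_prefix_length. Qed.

Lemma prefix_length_bound (n : nat) (l : 'I_n -> nat) (k : 'I_n) :
  prefix_length l k + l k <= \sum_j l j.
Proof. by rewrite -prefix_lengthS -prefix_length_full leq_prefix_length. Qed.

(** The position of dimension 0, which both rails leave out, is what decides
    the form of [down_start]; the two cases are packed for case analysis. *)
Lemma prefix_length_ord0 (n : nat) (l : 'I_n.+2 -> nat) (k : 'I_n.+2) :
  (if k == 0 :> nat then l k = l ord0 /\ prefix_length l k = 0
   else l ord0 <= prefix_length l k).
Proof.
case: eqP => [k0|/eqP k_gt0].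
  rewrite k0 prefix_length0; split=> //.
  by rewrite (_ : k = ord0) //; apply: val_inj.
rewrite -[l ord0]add0n -(prefix_length0 l).
by apply: (@prefix_length_sep _ l ord0); rewrite lt0n.
Qed.

(** Links the two descriptions of the walk, by time and by side. On
    a side along k another coordinate j is constantly 0 or l_j, according to
    the order in which the walk meets the sides along j and k. *)
Lemma height_side (n : nat) (l : 'I_n.+2 -> nat) (k : 'I_n.+2) up r j :
  r <= l k -> height l (side_pos l k up r) j = offset l k up r j.
Proof.
move=> le_r; rewrite /height /side_pos /offset /corner /down_start.
rewrite !prefix_lengthS -!val_eqE /=.
have := prefix_length_ord0 l j; have := prefix_length_ord0 l k.
have := prefix_length_bound l j; have := prefix_length_bound l k.
have := prefix_length_bound l ord0; rewrite prefix_length0.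
have := @prefix_length_sep _ l j k; have := @prefix_length_sep _ l k j.
case: (ltngtP j k) => [lt_jk|lt_kj|/val_inj ->].
- move=> _ /(_ isT); case: up; case: (posnP k) => k0;
  case: (posnP j) => j0; rewrite /= ?muln0 ?muln1; lia.
- move=> /(_ isT) + _; case: up; case: (posnP k) => k0;
  case: (posnP j) => j0; rewrite /= ?muln0 ?muln1; lia.
by move=> _ _; case: up; case: (posnP k) => k0; rewrite /= ?muln0 ?muln1; lia.
Qed.

Lemma height_le (n : nat) (l : 'I_n.+2 -> nat) (x : nat) (j : 'I_n.+2) :
  height l x j <= l j.
Proof. by rewrite /height; lia. Qed.

Lemma side_posP (n : nat) (l : 'I_n.+2 -> nat) (x : nat) :
    x < 2 * \sum_j l j ->
  exists k r, r < l k /\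
    (if x < \sum_j l j
     then x = side_pos l k true r /\ x.+1 = side_pos l k true r.+1
     else x = side_pos l k false r.+1 /\ x.+1 = side_pos l k false r).
Proof.
rewrite /side_pos /down_start; case: (ltnP x (\sum_j l j)).
  case/prefix_lengthP=> k le_x lt_x _.
  by exists k, (x - prefix_length l k); lia.
move=> le_Bx lt_x; have := prefix_length_bound l ord0.
rewrite prefix_length0 => le_l0.
case: (ltnP x (\sum_j l j + l ord0)) => [lt_x0|le_x0].
  exists ord0, (\sum_j l j + l ord0 - x.+1); rewrite [_ == 0 :> nat]eqxx; lia.
have [|k le_k lt_k] := @prefix_lengthP _ l (2 * \sum_j l j + l ord0 - x.+1).
  by lia.
exists k, (2 * \sum_j l j + l ord0 - x.+1 - prefix_length l k).
have := prefix_length_ord0 l k; have := prefix_length_bound l k.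
by rewrite prefix_lengthS; case: (posnP k) => k0; lia.
Qed.

Lemma side_posS (n : nat) (l : 'I_n.+2 -> nat) k r :
    r < l k ->
  (side_pos l k true r).+1 = side_pos l k true r.+1 /\
  (side_pos l k false r.+1).+1 = side_pos l k false r.
Proof. by rewrite /side_pos /down_start; lia. Qed.

Lemma side_pos_bound (n : nat) (l : 'I_n.+2 -> nat) k r :
    r < l k ->
  side_pos l k true r < 2 * \sum_j l j /\
  side_pos l k false r.+1 < 2 * \sum_j l j.
Proof.
rewrite /side_pos /down_start.
have := prefix_length_ord0 l k; have := prefix_length_bound l k.
by rewrite prefix_lengthS; case: (posnP k) => k0; lia.
Qed.

(** The walk climbs one unit per step during its first half and descends one
    unit per step during its second half. *)
Lemma height_step (n : nat) (l : 'I_n.+2 -> nat) (x : nat) :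
    x < 2 * \sum_j l j ->
  exists k, forall j,
    if x < \sum_j l j then height l x.+1 j = height l x j + (j == k)
    else height l x j = height l x.+1 j + (j == k).
Proof.
case/side_posP=> k [r [lt_r def_x]]; exists k => j; move: def_x.
have le_r := ltnW lt_r.
case: ifP => _ [-> ->]; rewrite !height_side // /offset;
  by rewrite -addnA mulnS [_ + (j == k) * r]addnC.
Qed.

Lemma height_sum (n : nat) (l : 'I_n.+2 -> nat) (x : nat) :
  x <= 2 * \sum_j l j ->
  \sum_j height l x j = minn x (2 * (\sum_j l j) - x).
Proof.
have h0 j : height l 0 j = 0 by rewrite /height !sub0n min0n.
elim: x => [|x IHx] lt_x; first by rewrite big1 ?min0n.
have [k step] := height_step lt_x; have IH := IHx (ltnW lt_x).
have sum1 : 1 = \sum_(j < n.+2) (j == k : nat).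
  by rewrite (bigD1 k) //= eqxx big1 // => j /negPf->.
move: step; case: (ltnP x (\sum_j l j)) => lt_xB step.
  have ->: \sum_j height l x.+1 j = (\sum_j height l x j) + 1.
    by rewrite sum1 -big_split; apply: eq_bigr => j _.
  by rewrite IH; lia.
have: \sum_j height l x j = (\sum_j height l x.+1 j) + 1.
  by rewrite sum1 -big_split; apply: eq_bigr => j _.
by rewrite IH => eqS; lia.
Qed.

(** The total height min(x, 2B - x) gives x up to reflection, and reflected
    times are told apart by coordinate 0. That coordinate is min(x, l_0) at
    time x and l_0 - min(B - x, l_0) at time 2B - x; for 0 < x < B equality
    would force B <= l_0. *)
Lemma height_inj (n : nat) (l : 'I_n.+2 -> nat) (x x' : nat) :
    (forall j, 0 < l j) ->
    x < 2 * \sum_j l j -> x' < 2 * \sum_j l j ->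
  height l x =1 height l x' -> x = x'.
Proof.
move=> l_gt0 lt_x lt_x' eq_h.
have := height_sum (ltnW lt_x); rewrite (eq_bigr _ (fun j _ => eq_h j)).
rewrite (height_sum (ltnW lt_x')).
have := eq_h ord0; rewrite /height /down_start /= prefix_length0.
have := prefix_length_bound l (lift ord0 ord0).
rewrite (prefix_lengthS l ord0) prefix_length0.
have := l_gt0 ord0; have := l_gt0 (lift ord0 ord0).
by move: (\sum_j l j) lt_x lt_x' => B; lia.
Qed.

Lemma height_period (n : nat) (l : 'I_n.+2 -> nat) (j : 'I_n.+2) :
  height l (2 * \sum_j l j) j = height l 0 j.
Proof.
rewrite /height /down_start !sub0n min0n.
have := prefix_length_ord0 l j; have := prefix_length_bound l j.
by rewrite prefix_lengthS; case: (posnP j) => j0; lia.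
Qed.

(** * Ladders as cycles *)

Definition point (n : nat) (q l : 'I_n.+2 -> nat) (v : grid q) (x : nat) :
    grid q :=
  shift (height l x) v.

(** The length b is twice the sum of the l_j; it is a parameter because other
    expressions of that number are needed as the index type of the walk. *)
Definition ladder (b n : nat) (q l : 'I_n.+2 -> nat) (v : grid q) :
    graph (grid q) :=
  map_graph (fun x : 'I_b => point l v x) (cycle_graph b).

Definition on_ladder (n : nat) (q l : 'I_n.+2 -> nat) (v t : grid q)
    (k : 'I_n.+2) : Prop :=
  exists up r, r < l k /\ t = shift (offset l k up r) v.

Lemma point_side (n : nat) (q l : 'I_n.+2 -> nat) (v : grid q) k up r :
  r <= l k -> point l v (side_pos l k up r) = shift (offset l k up r) v.
Proof. by move=> le_r; apply: shift_ext => j; apply: height_side. Qed.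

Lemma shift_offset (n : nat) (q l : 'I_n -> nat) (v : grid q) k up r :
  shift (offset l k up r) v
    = move k r (shift (fun j => l j * corner k up j) v).
Proof. by rewrite shift_move. Qed.

Lemma point_step (n : nat) (q l : 'I_n.+2 -> nat) (v : grid q) k up r :
    r < l k ->
  point l v (side_pos l k up r.+1) = move k 1 (point l v (side_pos l k up r)).
Proof.
move=> lt_r; rewrite !point_side //; last exact: ltnW.
by rewrite !shift_offset move1_move.
Qed.

Lemma point_ordS (b n : nat) (q l : 'I_n.+2 -> nat) (v : grid q) (x : 'I_b) :
  b = 2 * \sum_j l j -> point l v (ordS x) = point l v x.+1.
Proof.
move=> def_b; apply: closed_walk; apply: shift_ext => j.
by rewrite def_b height_period.
Qed.

Lemma ladder_edgesP (b n : nat) (q l : 'I_n.+2 -> nat) (v : grid q)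
    (E : {set grid q}) :
    b = 2 * \sum_j l j ->
  reflect (exists t k, on_ladder l v t k /\ E = edge_from t k)
          (E \in edges (ladder b l v)).
Proof.
move=> def_b; apply: (iffP (cycle_edgesP _ _)) => [[x ->]|].
  rewrite point_ordS //; have := ltn_ord x; rewrite [X in _ < X]def_b.
  case/side_posP=> k [r [lt_r def_x]]; have le_r := ltnW lt_r.
  move: def_x; case: ifP => _ [-> ->]; rewrite point_step //.
    exists (shift (offset l k true r) v), k; split; first by exists true, r.
    by rewrite point_side.
  exists (shift (offset l k false r) v), k; split; first by exists false, r.
  by rewrite point_side // setUC.
case=> t [k [[up [r [lt_r ->]]] ->]]; have le_r := ltnW lt_r.
have [upS downS] := side_posS lt_r; have [lt_up lt_down] := side_pos_bound lt_r.
rewrite /edge_from -point_side // -point_step //.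
case: up.
  have lt_b : side_pos l k true r < b by rewrite def_b.
  by exists (Ordinal lt_b); rewrite point_ordS //= upS.
have lt_b : side_pos l k false r.+1 < b by rewrite def_b.
by exists (Ordinal lt_b); rewrite point_ordS //= downS setUC.
Qed.

Lemma ladder_cycle (b n : nat) (q l : 'I_n.+2 -> nat) (v : grid q) :
    b = 2 * \sum_j l j -> (forall j, 0 < l j) -> (forall j, l j < q j) ->
  cycle_along (fun x : 'I_b => point l v x) (ladder b l v).
Proof.
move=> def_b l_gt0 lt_lq; split=> //.
  have := prefix_length_bound l (lift ord0 ord0).
  rewrite (prefix_lengthS l ord0).
  by have := l_gt0 ord0; have := l_gt0 (lift ord0 ord0); lia.
move=> x x' /shift_inj eq_h; apply/val_inj/(height_inj l_gt0).
- by rewrite -def_b ltn_ord.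
- by rewrite -def_b ltn_ord.
by apply: eq_h => j; apply: leq_ltn_trans (height_le _ _ _) (lt_lq j).
Qed.

(** The piece of index s of the r-th edge of a side along k is the edge of
    index w_k r + s of the long side, which is division with remainder by
    w_k. *)
Lemma subdivide_ladder (b b' n : nat) (y w l : 'I_n.+2 -> nat)
    (v : torus_grid y w) :
    b = 2 * \sum_j l j -> b' = 2 * \sum_j w j * l j ->
    (forall j, 0 < w j) -> (forall j, w j %| y j) ->
    (forall j, 2 < y j %/ w j) ->
  subdivide (ladder b l v) = ladder b' (fun j => w j * l j) (embed v).
Proof.
move=> def_b def_b' w_gt0 w_y q_gt2.
have embed_off k up r s :
    move k s (embed (shift (offset l k up r) v))
      = shift (offset (fun j => w j * l j) k up (w k * r + s)) (embed v).
  rewrite embed_shift // shift_move; apply: shift_ext => j; rewrite /offset.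
  by case: eqP => [->|_]; nia.
have eqE : edges (subdivide (ladder b l v))
           = edges (ladder b' (fun j => w j * l j) (embed v)).
  apply/setP => E; apply/subdivide_edgesP/(ladder_edgesP _ _ def_b').
    case=> t [k [s [/(ladder_edgesP _ _ def_b)[t' [k' [+ eq_e]]] lt_s ->]]].
    have [<- <-] := edge_from_inj q_gt2 eq_e => -[up [r [lt_r ->]]].
    rewrite embed_off; eexists _, k; split=> //; exists up, (w k * r + s).
    by split=> //; nia.
  case=> _ [k [[up [r [lt_r ->]]] ->]].
  exists (shift (offset l k up (r %/ w k)) v), k, (r %% w k); split.
  - apply/(ladder_edgesP _ _ def_b); do 2!eexists; split=> //.
    by exists up, (r %/ w k); rewrite ltn_divLR // mulnC.
  - by rewrite ltn_mod.
  by rewrite embed_off [w k * _]mulnC -divn_eq.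
apply: graph_ext => //; rewrite [RHS]cycle_cover -eqE.
apply: subdivide_cover => //; last exact: cycle_cover.
apply/subsetP=> E /(ladder_edgesP _ _ def_b)[t [k [_ ->]]].
exact: torus_edge.
Qed.

(** With d = n + 2, side s of the walk is the upward side along s if s < d,
    and the downward side along (2d - s) mod d otherwise; the modulus sends
    s = d to dimension 0. *)
Lemma ladder_square (n lam : nat) (q : 'I_n.+2 -> nat) (v : grid q) :
    0 < lam -> (forall j, lam < q j) ->
  square_cycle lam (ladder (2 * n.+2 * lam) (fun=> lam) v).
Proof.
move=> lam_gt0 lt_q; set l : 'I_n.+2 -> nat := fun=> lam.
have sum_l : \sum_j l j = n.+2 * lam by rewrite sum_nat_const card_ord.
have def_b : 2 * n.+2 * lam = 2 * \sum_j l j by rewrite sum_l mulnA.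
have prefixE (k : nat) : k <= n.+2 -> prefix_length l k = k * lam.
  elim: k => [|k IHk] lt_k; first by rewrite prefix_length0.
  by rewrite (prefix_lengthS l (Ordinal lt_k)) IHk ?(ltnW lt_k) // mulSn addnC.
pose dim (s : 'I_(2 * n.+2)) : 'I_n.+2 :=
  inord (if s < n.+2 then s : nat else (2 * n.+2 - s) %% n.+2).
have dimE s :
    dim s = (if s < n.+2 then s : nat else (2 * n.+2 - s) %% n.+2) :> nat.
  by rewrite inordK //; case: ifP => // _; rewrite ltn_mod.
exists (fun x => point l v x), dim, (fun s => s < n.+2); split.
- by apply: ladder_cycle => // j; apply: lt_q.
- move=> k.
  have lt_a : k < 2 * n.+2 by have := ltn_ord k; lia.
  have lt_c : (if k == 0 :> nat then n.+2 else 2 * n.+2 - k) < 2 * n.+2.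
    by case: eqP; lia.
  rewrite (_ : [set s | _] = [set Ordinal lt_a; Ordinal lt_c]).
    rewrite cards2 -val_eqE /=; have := ltn_ord k.
    by case: (nat_of_ord k =P 0); lia.
  apply/setP => s; rewrite !inE -!val_eqE /= dimE.
  have := ltn_ord s; have := ltn_ord k.
  case: (ltnP s n.+2) => [|le_s lt_k lt_s].
    by case: (nat_of_ord k =P 0); lia.
  case: (ltngtP n.+2 s) le_s => // [lt|<-] _.
    by rewrite modn_small; [case: (nat_of_ord k =P 0); lia | lia].
  rewrite (_ : 2 * _ - _ = n.+2) ?modnn; last by lia.
  by case: (nat_of_ord k =P 0); lia.
move=> s x def_s; rewrite point_ordS //.
have lt_r := ltn_pmod x lam_gt0; have def_x := divn_eq x lam.
move: def_x lt_r; rewrite def_s; move: (x %% lam) => r def_x lt_r.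
have dim_s := dimE s; move: dim_s; case: ifP => lt_s dim_s.
  have ->: x = side_pos l (dim s) true r :> nat.
    by rewrite /side_pos prefixE ?dim_s // ltnW.
  have [-> _] := @side_posS _ l (dim s) r lt_r.
  exact: point_step.
have lt_r' : lam - r.+1 < l (dim s) by rewrite /l; lia.
have [_ downS] := side_posS lt_r'.
have ->: x = side_pos l (dim s) false (lam - r.+1).+1 :> nat.
  rewrite /side_pos /down_start prefixE // sum_l dim_s /l.
  have := ltn_ord s; case: (ltngtP n.+2 s) => [lt||eq_s] lt_s2; try by lia.
    by rewrite modn_small; last lia; case: eqP; nia.
  rewrite -eq_s (_ : 2 * _ - _ = n.+2) ?modnn /=; last by lia.
  by move: def_x; rewrite -eq_s; lia.
by rewrite downS point_step.
Qed.

(** * Partition of the edges of a torus into ladders *)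

Lemma shift_injl (d : nat) (q m : 'I_d -> nat) : injective (@shift d q m).
Proof.
move=> t t' eq_t; apply: grid_inj => k.
have := congr1 (fun u : grid q => u k : nat) eq_t; rewrite /= !shiftE => /eqP.
by rewrite eqn_modDr !modn_small // => /eqP.
Qed.

Lemma shift_onto (d : nat) (q m : 'I_d -> nat) (t : grid q) :
  exists u, t = shift m u.
Proof.
by have [g _ gK] := injF_bij (@shift_injl d q m); exists (g t).
Qed.

Lemma sum_shift (d lam : nat) (q m : 'I_d -> nat) (t : grid q) :
    (forall j, lam %| q j) ->
  \sum_j shift m t j = \sum_j t j + \sum_j m j %[mod lam].
Proof.
move=> lam_q; rewrite -big_split /= -[LHS]modn_summ -[RHS]modn_summ.
by congr (_ %% _); apply: eq_bigr => j _; rewrite shiftE modn_dvdm.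
Qed.

(** The torus is cut into cubes of side lam. As every q_j is an even multiple
    of lam, the parity of an index of a cube survives the wrap-around. *)
Definition cell_parity (n lam : nat) (q : 'I_n.+2 -> nat) (t : grid q) : bool :=
  odd (t ord0 %/ lam) (+) odd (t (lift ord0 ord0) %/ lam).

Lemma cell_parity_shift (n lam : nat) (q c : 'I_n.+2 -> nat) (t : grid q) :
    0 < lam -> (forall j, 2 * lam %| q j) ->
  cell_parity lam (shift (fun j => lam * c j) t)
    = cell_parity lam t (+) (odd (c ord0) (+) odd (c (lift ord0 ord0))).
Proof.
move=> lam_gt0 lam_q.
have odd_shift j : odd (shift (fun j => lam * c j) t j %/ lam)
                   = odd (t j %/ lam) (+) odd (c j).
  rewrite shiftE; have /dvdnP[s def_q] := lam_q j.
  rewrite [X in _ %% X]def_q [s * _]mulnA -modn_divl [lam * _]mulnC divnDMl //.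
  by rewrite odd_mod ?oddD // muln2 odd_double.
by rewrite /cell_parity !odd_shift addbACA.
Qed.

Definition ladder_bases (n lam : nat) (q : 'I_n.+2 -> nat) : {set grid q} :=
  [set v : grid q | (lam %| \sum_j v j) && ~~ cell_parity lam v].

(** For a given k the two values of [up] give opposite parities: this is what
    makes the choice of bases work. *)
Lemma corner_parity (n : nat) (k : 'I_n.+2) up :
  odd (corner k up ord0) (+) odd (corner k up (lift ord0 ord0))
    = up (+) (k != 1 :> nat).
Proof. by case: k => -[|[|k]] lt_k; case: up. Qed.

Lemma ladder_partition (n lam : nat) (q : 'I_n.+2 -> nat) (t : grid q) k :
    0 < lam -> (forall j, 2 * lam %| q j) ->
  exists v, [/\ v \in ladder_bases lam q, on_ladder (fun=> lam) v t k
     & forall v', v' \in ladder_bases lam q -> on_ladder (fun=> lam) v' t k ->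
       v' = v].
Proof.
move=> lam_gt0 lam2_q.
have lam_q j : lam %| q j by apply: dvdn_trans (lam2_q j); apply: dvdn_mull.
pose r := (\sum_j t j) %% lam.
have [u def_t] := shift_onto (fun j => (j == k) * r) t.
pose up := cell_parity lam u (+) (k != 1 :> nat).
have [v def_u] := shift_onto (fun j => lam * corner k up j) u.
have sum_off (v' : grid q) up' r' :
    \sum_j shift (offset (fun=> lam) k up' r') v' j
      = \sum_j v' j + r' %[mod lam].
  have sum_r : \sum_(j < n.+2) (j == k) * r' = r'.
    by rewrite (bigD1 k) //= eqxx mul1n big1 ?addn0 // => j /negPf->.
  rewrite sum_shift // /offset.
  by rewrite big_split -big_distrr /= sum_r addnCA mulnC modnMDl.
have def_tv : t = shift (offset (fun=> lam) k up r) v.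
  by rewrite shift_offset -def_u move_shift.
exists v; split.
- rewrite inE; apply/andP; split.
    have := sum_off v up r; rewrite -def_tv => /eqP.
    by rewrite -[X in X == _]modn_mod -/r -[r]add0n eqn_modDr mod0n eq_sym.
  have := cell_parity_shift (fun j => corner k up j : nat) v lam_gt0 lam2_q.
  rewrite -def_u corner_parity /up.
  by case: (cell_parity _ u); case: (cell_parity _ v); case: (k != 1 :> nat).
- by exists up, r; rewrite ltn_mod.
move=> v'; rewrite inE => /andP[lam_v' par_v'] [up' [r' [lt_r' def_tv']]].
(* The coordinate sum of t modulo lam gives r, whatever the base. *)
have eq_r : r' = r.
  have /eqP := sum_off v' up' r'; rewrite -def_tv' /r => /eqP->.
  by rewrite -modnDml (eqP lam_v') add0n modn_small.
have eq_u : u = shift (fun j => lam * corner k up' j) v'.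
  apply: (@shift_injl _ _ (fun j => (j == k) * r)).
  by rewrite -def_t def_tv' shift_offset move_shift eq_r.
(* The parity of the cell of u gives the side. *)
have eq_up : up' = up.
  have := cell_parity_shift (fun j => corner k up' j : nat) v' lam_gt0 lam2_q.
  rewrite -eq_u corner_parity /up (negPf par_v') => ->.
  by rewrite addFb addbK.
apply: (@shift_injl _ _ (fun j => lam * corner k up j)).
by rewrite -def_u eq_u eq_up.
Qed.

(** [ladder_partition] for oriented edges, transferred to edges. *)
Lemma torus_ladders (n lam b : nat) (q : 'I_n.+2 -> nat) :
    0 < lam -> b = 2 * \sum_(j < n.+2) lam ->
    (forall j, 2 * lam %| q j) -> (forall j, 2 < q j) ->
  decomposition (torus q)
    (fun c : 'I_#|ladder_bases lam q| => ladder b (fun=> lam) (enum_val c)).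
Proof.
move=> lam_gt0 def_b lam2_q q_gt2.
have cover_edge t k : exists c : 'I_#|ladder_bases lam q|,
    edge_from t k \in edges (ladder b (fun=> lam) (enum_val c)).
  have [v [vP v_t _]] := ladder_partition t k lam_gt0 lam2_q.
  exists (enum_rank_in vP v); apply/(ladder_edgesP _ _ def_b).
  by exists t, k; rewrite enum_rankK_in.
split=> [c c' neq_c||].
- rewrite disjoint_subset; apply/subsetP => E.
  case/(ladder_edgesP _ _ def_b)=> t [k [ct ->]]; apply/negP.
  case/(ladder_edgesP _ _ def_b)=> t' [k' [+ /(edge_from_inj q_gt2)]].
  move=> + [eq_t eq_k]; rewrite -eq_t -eq_k => c't.
  have [v [_ _ uniq_v]] := ladder_partition t k lam_gt0 lam2_q.
  case/eqP: neq_c; apply: enum_val_inj.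
  by rewrite (uniq_v _ (enum_valP c) ct) (uniq_v _ (enum_valP c') c't).
- apply/setP => t; rewrite torus_verts; apply/bigcupP.
  have [c tc] := cover_edge t ord0; exists c => //.
  rewrite cycle_cover; apply/bigcupP.
  by exists (edge_from t ord0); rewrite // set21.
apply/setP => E; apply/bigcupP/idP => [[c _]|/torus_edgesP[t [k ->]]].
  by case/(ladder_edgesP _ _ def_b)=> t [k [_ ->]]; apply: torus_edge.
by have [c tc] := cover_edge t k; exists c.
Qed.

(** * Square decompositions of anchored products of cycles *)

Lemma anchored_square_decomposition (n lam : nat) (y w : 'I_n.+2 -> nat) :
    0 < lam -> (forall j, 0 < w j) -> (forall j, w j %| y j) ->
    (forall j, 2 * lam %| y j %/ w j) -> (forall j, 2 < y j %/ w j) ->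
  exists (N : nat) (F : 'I_N -> graph (grid y)),
    square_decomposition w lam F /\
    forall c, is_cycle (2 * lam * \sum_j w j) (F c).
Proof.
move=> lam_gt0 w_gt0 w_y lam_q q_gt2.
pose q j := y j %/ w j.
have sum_lam : 2 * n.+2 * lam = 2 * \sum_(j < n.+2) lam.
  by rewrite sum_nat_const card_ord mulnA.
have sum_w : 2 * lam * (\sum_j w j) = 2 * \sum_j w j * lam.
  by rewrite -big_distrl /= -mulnA [lam * _]mulnC.
pose D (c : 'I_#|ladder_bases lam q|) :=
  ladder (2 * n.+2 * lam) (fun=> lam) (enum_val c).
have lt_lq j : lam < q j.
  by have := dvdn_leq (ltnW (ltnW (q_gt2 j))) (lam_q j); rewrite -/(q j); lia.
have lt_qy j : w j * lam < y j.
  by rewrite -(divnK (w_y j)) mulnC ltn_pmul2r //; apply: lt_lq.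
exists #|ladder_bases lam q|, (fun c => subdivide (D c)).
have cyc c : is_cycle (2 * lam * \sum_j w j) (subdivide (D c)).
  rewrite (subdivide_ladder _ sum_lam sum_w) //.
  exists (fun x => point (fun j => w j * lam) (embed (enum_val c)) x).
  by apply: ladder_cycle => // j; rewrite muln_gt0 w_gt0.
have decD : decomposition (torus q) D by apply: torus_ladders.
split=> //; split.
- apply: subdivide_decomposition => // j.
  by apply: leq_trans (q_gt2 j) (leq_div _ _).
- by move=> c; eexists; apply: cyc.
by exists D; split=> // c; apply: ladder_square.
Qed.

Lemma sum_factor_index (d : nat) (f : nat -> nat) :
  2 <= d -> \sum_(p < d) f (factor_index d p) = \sum_(1 <= k < d.+1) f k.
Proof.
case: d => [|[|[|d]]] // _.
  by rewrite !big_ord_recr big_ord0 /= big_ltn // big_nat1.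
rewrite -(big_mkord xpredT (fun p => f (factor_index d.+3 p))).
rewrite big_ltn // big_ltn // big_ltn // [RHS]big_ltn // [in RHS]big_ltn //.
rewrite [X in _ = _ + (_ + X)]big_nat_recr //= [X in _ = _ + (_ + X)]addnC.
congr (_ + (_ + (_ + _))).
by rewrite big_nat_cond [RHS]big_nat_cond; apply: eq_bigr => -[|[|[|p]]].
Qed.

Theorem corollary4 (n d a : nat) (i : nat -> nat)
  (hn : 1 <= n) (hd : 2 <= d)
  (hi : forall j k : nat, 1 <= j -> j < k -> k <= d -> i k < i j)
  (hid : i d = 0)
  (ha : a = \sum_(1 <= k < d.+1) 2 ^ i k)
  (alpha : nat) (halpha : 1 <= alpha <= 2 * n) :
  exists (N : nat)
         (F : 'I_N -> graph {dffun forall p : 'I_d, 'I_(factor_length n i p)}),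
    square_decomposition (factor_spacing i) (2 ^ (alpha - 1)) F /\
    (forall c : 'I_N, is_cycle (a * 2 ^ alpha) (F c)).
Proof.
have [alpha_gt0 le_alpha] := andP halpha.
have two_lam : 2 * 2 ^ (alpha - 1) = 2 ^ alpha by rewrite -expnS subn1 prednK.
(* 2^(2n) divides the number 2^(n 2^(m+1) - m) of anchors. *)
have exp_ge m : m + 2 * n <= n * 2 ^ m.+1.
  elim: m => [|m IHm]; first by rewrite mulnC.
  by rewrite expnS; have := expn_gt0 2 m.+1; nia.
have sum_w : \sum_(p < d) factor_spacing i p = a.
  by rewrite ha -(sum_factor_index (fun k => 2 ^ i k) hd).
rewrite mulnC -two_lam -{}sum_w.
have quot (p : 'I_d) : factor_length n i p %/ factor_spacing i p
    = 2 ^ (n * 2 ^ (i (factor_index d p)).+1 - i (factor_index d p)).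
  by rewrite expnB //; have := exp_ge (i (factor_index d p)); lia.
have quot_dvd (p : 'I_d) :
    2 ^ (2 * n) %| factor_length n i p %/ factor_spacing i p.
  by rewrite quot dvdn_exp2l //; have := exp_ge (i (factor_index d p)); lia.
case: d hd {hi hid ha} quot quot_dvd => [|[|d]] // _ quot quot_dvd.
apply: anchored_square_decomposition => [|p|p|p|p].
- by rewrite expn_gt0.
- by rewrite expn_gt0.
- by apply: dvdn_exp2l; have := exp_ge (i (factor_index d.+2 p)); lia.
- by apply: dvdn_trans (quot_dvd p); rewrite two_lam dvdn_exp2l.
rewrite quot; apply: (@leq_trans (2 ^ 2)) => //; rewrite leq_exp2l //.
by have := exp_ge (i (factor_index d.+2 p)); lia.
Qed.
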